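(* (Completeness.) Let $\equiv$ be the equivalence on GKAT expressions generated by the GKAT axioms together with the uniqueness axiom. Then the axioms are complete with respect to $[\![-]\!]$: for all $e_1,e_2\in\mathrm{Exp}$, \[ [\![e_1]\!]=[\![e_2]\!]\quad\Longrightarrow\quad e_1\equiv e_2. \]
   Context: Syntax. Fix disjoint nonempty sets $\Sigma$ (actions) and $T$ (primitive tests), $T$ finite. Boolean expressions $b,c\in\mathrm{BExp}$ are generated by $0 \mid 1 \mid t\in T \mid b\cdot c \mid b+c \mid \overline{b}$. GKAT expressions $e,f,g\in\mathrm{Exp}$ are generated by $p\in\Sigma \mid b\in\mathrm{BExp} \mid e\cdot f \mid e+_b f \mid e^{(b)}$; $ef$ abbreviates $e\cdot f$. $\equiv_{BA}$ denotes Boolean equivalence, $b\le c$ iff $b+c\equiv_{BA}c$. $\mathrm{At}$ is the finite set of atoms (minimal nonzero elements) of the free Boolean algebra $\mathrm{BExp}/{\equiv_{BA}}$ on $T$. Language model. Guarded strings: $\mathrm{GS}=\mathrm{At}\cdot(\Sigma\cdot\mathrm{At})^*$. Fusion product: $x\alpha\diamond\beta y = x\alpha y$ if $\alpha=\beta$, undefined otherwise; for $L,K\subseteq\mathrm{GS}$, $L\diamond K=\{x\diamond y : x\in L,y\in K, x\diamond y\text{ defined}\}$; $L^0=\mathrm{At}$, $L^{n+1}=L^n\diamond L$. For $B\subseteq\mathrm{At}$, $\overline{B}=\mathrm{At}\setminus B$, $L+_BK=(B\diamond L)\cup(\overline{B}\diamond K)$, $L^{(B)}=\bigcup_{n\ge0}(B\diamond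 L)^n\diamond\overline{B}$. Then $[\![-]\!]:\mathrm{Exp}\to 2^{\mathrm{GS}}$ is: $[\![p]\!]=\{\alpha p\beta:\alpha,\beta\in\mathrm{At}\}$, $[\![b]\!]=\{\alpha\in\mathrm{At}:\alpha\le b\}$, $[\![e\cdot f]\!]=[\![e]\!]\diamond[\![f]\!]$, $[\![e+_bf]\!]=[\![e]\!]+_{[\![b]\!]}[\![f]\!]$, $[\![e^{(b)}]\!]=[\![e]\!]^{([\![b]\!])}$. Axioms. $E:\mathrm{Exp}\to\mathrm{BExp}$ is defined by $E(b)=b$, $E(p)=0$, $E(e+_bf)=b\cdot E(e)+\overline{b}\cdot E(f)$, $E(e\cdot f)=E(e)\cdot E(f)$, $E(e^{(b)})=\overline{b}$. The relation $\equiv$ is the smallest congruence (with respect to all operators) on $\mathrm{Exp}$ such that $b\equiv_{BA}c$ implies $b\equiv c$, such that for all $e,f,g\in\mathrm{Exp}$, $b,c\in\mathrm{BExp}$: (U1) $e+_be\equiv e$; (U2) $e+_bf\equiv f+_{\overline{b}}e$; (U3) $(e+_bf)+_cg\equiv e+_{bc}(f+_cg)$; (U4) $e+_bf\equiv be+_bf$; (U5) $eg+_bfg\equiv(e+_bf)\cdot g$; (S1) $(e\cdot f)\cdot g\equiv e\cdot(f\cdot g)$; (S2) $0\cdot e\equiv0$; (S3) $e\cdot0\equiv0$; (S4) $1\cdot e\equiv e$; (S5) $e\cdot1\equiv e$; (W1) $e^{(b)}\equiv ee^{(b)}+_b1$; (W2) $(e+_c1)^{(b)}\equiv(ce)^{(b)}$;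 (W3) if $g\equiv eg+_bf$ and $E(e)\equiv0$, then $g\equiv e^{(b)}f$; and which is closed under the uniqueness axiom: any Salomaa system of left-affine equations has at most one solution modulo $\equiv$, i.e. whenever $s,s'$ are solutions to a Salomaa system, $s(x_i)\equiv s'(x_i)$ for all $i$. Systems. A system of left-affine equations is a finite set of equations $x_i=e_{i1}x_1+_{b_{i1}}\cdots+_{b_{i(n-1)}}e_{in}x_n+_{b_{in}}d_i$ ($1\le i\le n$), where $+_b$ associates to the right, the $x_i$ are variables, $e_{ij}\in\mathrm{Exp}$, and $b_{ij},d_i\in\mathrm{BExp}$ satisfy, in each row $i$: $b_{ij}\cdot b_{ik}\equiv_{BA}0$ for all $j\ne k$, and $b_{ij}\cdot d_i\equiv_{BA}0$ for all $j$. It is Salomaa if $E(e_{ij})\equiv0$ for all $i,j$. A solution is a function $s:\{x_1,\dots,x_n\}\to\mathrm{Exp}$ with $s(x_i)\equiv e_{i1}\cdot s(x_1)+_{b_{i1}}\cdots+_{b_{i(n-1)}}e_{in}\cdot s(x_n)+_{b_{in}}d_i$ for all $i$. *)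

(* Defs.v *)
From HB Require Import structures.
From mathcomp Require Import all_boot generic_quotient.
From mathcomp Require Import boolp classical_sets.

Set Implicit Arguments.
Unset Strict Implicit.
Unset Printing Implicit Defensive.

Local Open Scope classical_set_scope.

Declare Scope bexp_scope.
Delimit Scope bexp_scope with B.
Declare Scope gkat_scope.
Delimit Scope gkat_scope with G.

Inductive bexp (T : Type) : Type :=
| BZero
| BOne
| BPrim of T
| BAnd of bexp T & bexp T
| BOr of bexp T & bexp T
| BNot of bexp T.

Arguments BZero {T}.
Arguments BOne {T}.
Arguments BPrim {T}.
Bind Scope bexp_scope with bexp.

Notation "0" := BZero : bexp_scope.
Notation "1" := BOne : bexp_scope.
Notation "b * c" := (BAnd b c) : bexp_scope.
Notation "b + c" := (BOr b c) : bexp_scope.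
Notation "~` b" := (BNot b) : bexp_scope.

Reserved Notation "b =BA c" (at level 70, no associativity).

(* The congruence generated by the Boolean algebra axioms: [bexp T] modulo
   [=BA] is the free Boolean algebra on [T]. *)
Inductive ba_eq (T : Type) : bexp T -> bexp T -> Prop :=
| ba_refl b : b =BA b
| ba_sym b c : b =BA c -> c =BA b
| ba_trans b c d : b =BA c -> c =BA d -> b =BA d
| ba_and b b' c c' : b =BA b' -> c =BA c' -> (b * c)%B =BA (b' * c')%B
| ba_or b b' c c' : b =BA b' -> c =BA c' -> (b + c)%B =BA (b' + c')%B
| ba_not b b' : b =BA b' -> (~` b)%B =BA (~` b')%B
| ba_andA b c d : (b * (c * d))%B =BA ((b * c) * d)%B
| ba_orA b c d : (b + (c + d))%B =BA ((b + c) + d)%B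
| ba_andC b c : (b * c)%B =BA (c * b)%B
| ba_orC b c : (b + c)%B =BA (c + b)%B
| ba_andDr b c d : (b * (c + d))%B =BA (b * c + b * d)%B
| ba_orDr b c d : (b + (c * d))%B =BA ((b + c) * (b + d))%B
| ba_and1 b : (b * 1)%B =BA b
| ba_or0 b : (b + 0)%B =BA b
| ba_andN b : (b * ~` b)%B =BA 0%B
| ba_orN b : (b + ~` b)%B =BA 1%B
where "b =BA c" := (ba_eq b c).

Definition ba_le (T : Type) (b c : bexp T) : Prop := (b + c)%B =BA c.

Section FreeBooleanAlgebra.
Variable T : Type.

HB.instance Definition _ := gen_eqMixin (bexp T).
HB.instance Definition _ := gen_choiceMixin (bexp T).

Definition ba_eqb : rel (bexp T) := fun b c => `[< b =BA c >].

Lemma ba_eqb_refl : reflexive ba_eqb.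
Proof. by move=> b; apply/asboolP; exact: ba_refl. Qed.

Lemma ba_eqb_sym : symmetric ba_eqb.
Proof.
by move=> b c; apply/asboolP/asboolP => h; exact: ba_sym h.
Qed.

Lemma ba_eqb_trans : transitive ba_eqb.
Proof.
by move=> c b d /asboolP hbc /asboolP hcd; apply/asboolP; exact: ba_trans hcd.
Qed.

Canonical ba_eqb_equiv := EquivRel ba_eqb ba_eqb_refl ba_eqb_sym ba_eqb_trans.

Definition freeBA := {eq_quot ba_eqb}%qT.

HB.instance Definition _ := Choice.on freeBA.
HB.instance Definition _ := EqQuotient.on freeBA.

Definition ba_class (b : bexp T) : freeBA := \pi_freeBA%qT b.

Definition fba_le (x y : freeBA) : Prop := ba_le (repr x) (repr y).

Definition is_atom (x : freeBA) : Prop :=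
  x <> ba_class 0 /\
  forall y : freeBA, fba_le y x -> y = ba_class 0 \/ y = x.

Definition atom := {x : freeBA | `[< is_atom x >]}.

HB.instance Definition _ := Choice.on atom.

Definition atom_le (a : atom) (b : bexp T) : Prop :=
  fba_le (val a) (ba_class b).

End FreeBooleanAlgebra.

Inductive exp (Sigma T : Type) : Type :=
| Act of Sigma
| Test of bexp T
| Seq of exp Sigma T & exp Sigma T
| Cond of exp Sigma T & bexp T & exp Sigma T
| Loop of exp Sigma T & bexp T.

Arguments Act {Sigma T}.
Arguments Test {Sigma T}.
Bind Scope gkat_scope with exp.
Arguments Test {Sigma T} b%_B.
Arguments Seq {Sigma T} (e f)%_G.
Arguments Cond {Sigma T} e%_G b%_B f%_G.
Arguments Loop {Sigma T} e%_G b%_B.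

Notation "[? b ]" := (Test b)
  (at level 0, b at level 200, format "[?  b  ]") : gkat_scope.
Notation "e * f" := (Seq e f) : gkat_scope.
Notation "e +[ b ] f" := (Cond e b f)
  (at level 50, b at level 200, left associativity,
   format "e  +[ b ]  f") : gkat_scope.
Notation "e ^[ b ]" := (Loop e b)
  (at level 30, b at level 200, format "e ^[ b ]") : gkat_scope.

Section Language.
Variables Sigma T : Type.

(* The guarded string a0 p1 a1 ... pn an is (a0, [:: (p1, a1); ...; (pn, an)]). *)
Definition gs : Type := atom T * seq (Sigma * atom T).

Definition gs_last (x : gs) : atom T := last x.1 (unzip2 x.2).

Definition gs_fusion (x y : gs) : option gs :=
  if gs_last x == y.1 then Some (x.1, x.2 ++ y.2) else None.

Definition lfusion (L K : set gs) : set gs :=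
  [set z | exists x y, [/\ L x, K y & gs_fusion x y = Some z]].

(* A set of atoms, seen as a set of guarded strings of length one. *)
Definition latoms (B : set (atom T)) : set gs :=
  [set x | exists2 a, B a & x = (a, [::])].

Fixpoint lpow (L : set gs) (n : nat) : set gs :=
  if n is n'.+1 then lfusion (lpow L n') L else latoms setT.

Definition lcond (L : set gs) (B : set (atom T)) (K : set gs) : set gs :=
  lfusion (latoms B) L `|` lfusion (latoms (~` B)) K.

Definition lloop (L : set gs) (B : set (atom T)) : set gs :=
  \bigcup_n lfusion (lpow (lfusion (latoms B) L) n) (latoms (~` B)).

Definition atoms_below (b : bexp T) : set (atom T) := [set a | atom_le a b].

Fixpoint lang (e : exp Sigma T) : set gs :=
  match e with
  | Act p => [set x | exists a b, x = (a, [:: (p, b)])]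
  | Test b => latoms (atoms_below b)
  | Seq e f => lfusion (lang e) (lang f)
  | Cond e b f => lcond (lang e) (atoms_below b) (lang f)
  | Loop e b => lloop (lang e) (atoms_below b)
  end.

End Language.

Fixpoint E (Sigma T : Type) (e : exp Sigma T) : bexp T :=
  match e with
  | Act _ => 0
  | Test b => b
  | Seq e f => E e * E f
  | Cond e b f => b * E e + ~` b * E f
  | Loop _ b => ~` b
  end%B.

Record affine_system (Sigma T : Type) (n : nat) := AffineSystem {
  coef : 'I_n -> 'I_n -> exp Sigma T;
  guard : 'I_n -> 'I_n -> bexp T;
  rest : 'I_n -> bexp T;
  guard_disj : forall i j k, j != k -> (guard i j * guard i k)%B =BA 0%B;
  rest_disj : forall i j, (guard i j * rest i)%B =BA 0%B
}.

Definition affine_rhs (Sigma T : Type) (n : nat) (S : affine_system Sigma T n)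
    (s : 'I_n -> exp Sigma T) (i : 'I_n) : exp Sigma T :=
  foldr (fun j f => coef S i j * s j +[guard S i j] f)%G
        [? rest S i]%G (enum 'I_n).

Definition is_salomaa (Sigma T : Type) (R : exp Sigma T -> exp Sigma T -> Prop)
    (n : nat) (S : affine_system Sigma T n) : Prop :=
  forall i j, R [? E (coef S i j)]%G [? 0]%G.

Definition is_solution (Sigma T : Type) (R : exp Sigma T -> exp Sigma T -> Prop)
    (n : nat) (S : affine_system Sigma T n) (s : 'I_n -> exp Sigma T) : Prop :=
  forall i, R (s i) (affine_rhs S s i).

Reserved Notation "e == f" (at level 70, no associativity).

(* [bexp] is included in [exp] on paper, so that the product of two tests is
   the same expression whether it is read as a conjunction or as a sequential
   composition; [geq_and] identifies the two readings. By the same inclusion,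
   guards and the other Boolean operators are arguments of operators to which
   the congruence rules apply. *)
Inductive gkat_eq (Sigma T : Type) : exp Sigma T -> exp Sigma T -> Prop :=
| geq_refl e : (e == e)%G
| geq_sym e f : (e == f)%G -> (f == e)%G
| geq_trans e f g : (e == f)%G -> (f == g)%G -> (e == g)%G
| geq_seq e e' f f' : (e == e')%G -> (f == f')%G -> (e * f == e' * f')%G
| geq_cond e e' b b' f f' :
    (e == e')%G -> ([? b] == [? b'])%G -> (f == f')%G ->
    (e +[b] f == e' +[b'] f')%G
| geq_loop e e' b b' :
    (e == e')%G -> ([? b] == [? b'])%G -> (e ^[b] == e' ^[b'])%G
| geq_or b b' c c' :
    ([? b] == [? b'])%G -> ([? c] == [? c'])%G -> ([? b + c] == [? b' + c'])%G
| geq_not b b' : ([? b] == [? b'])%G -> ([? ~` b] == [? ~` b'])%G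
| geq_and b c : ([? b * c] == [? b] * [? c])%G
| geq_BA b c : b =BA c -> ([? b] == [? c])%G
| geq_U1 e b : (e +[b] e == e)%G
| geq_U2 e b f : (e +[b] f == f +[~` b] e)%G
| geq_U3 e b f c g : ((e +[b] f) +[c] g == e +[b * c] (f +[c] g))%G
| geq_U4 e b f : (e +[b] f == [? b] * e +[b] f)%G
| geq_U5 e b f g : (e * g +[b] f * g == (e +[b] f) * g)%G
| geq_S1 e f g : ((e * f) * g == e * (f * g))%G
| geq_S2 e : ([? 0] * e == [? 0])%G
| geq_S3 e : (e * [? 0] == [? 0])%G
| geq_S4 e : ([? 1] * e == e)%G
| geq_S5 e : (e * [? 1] == e)%G
| geq_W1 e b : (e ^[b] == e * e ^[b] +[b] [? 1])%G
| geq_W2 e b c : ((e +[c] [? 1]) ^[b] == ([? c] * e) ^[b])%G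
| geq_W3 e b f g :
    (g == e * g +[b] f)%G -> ([? E e] == [? 0])%G -> (g == e ^[b] * f)%G
| geq_UA n (S : affine_system Sigma T n) (s s' : 'I_n -> exp Sigma T) :
    is_salomaa (@gkat_eq Sigma T) S ->
    is_solution (@gkat_eq Sigma T) S s ->
    is_solution (@gkat_eq Sigma T) S s' ->
    forall i, (s i == s' i)%G
where "e == f" := (gkat_eq e f) : gkat_scope.

(* Main.v *)
(** Two expressions are equal as soon as their restrictions to every atom are.
    Restricted to an atom [a], an expression is provably equal to its Brzozowski
    derivative at [a]: reject, accept, or [p * e'] for an action [p].  An
    expression has finitely many iterated derivatives, so a finite list of pairs
    that is closed under derivatives atom by atom is solved, as a Salomaa
    system, by its left and by its right components, and the uniqueness axiom
    identifies these.  Applied to the pairs (dead derivative, 0), this shows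
    that an expression with empty language is equal to 0; hence transitions to
    dead expressions can be treated as rejections, and the pairs of derivatives
    of [e1] and [e2] with equal languages form a closed list. *)

Require Import Defs.
From HB Require Import structures.
From mathcomp Require Import all_boot generic_quotient.
From mathcomp Require Import boolp classical_sets.
From Stdlib Require Import Setoid Morphisms.

Set Implicit Arguments.
Unset Strict Implicit.
Unset Printing Implicit Defensive.

Notation "b =BA c" := (ba_eq b c).
Notation "e == f" := (gkat_eq e f) : gkat_scope.

(** * Boolean algebra, and atoms as two-valued valuations *)

#[export] Instance ba_eq_Equivalence T : Equivalence (@ba_eq T).
Proof. by split; [exact: ba_refl|exact: ba_sym|exact: ba_trans]. Qed.
#[export] Instance BAnd_Proper T :
  Proper (@ba_eq T ==> @ba_eq T ==> @ba_eq T) (@BAnd T).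
Proof. by move=> b b' hb c c' hc; exact: ba_and. Qed.
#[export] Instance BOr_Proper T :
  Proper (@ba_eq T ==> @ba_eq T ==> @ba_eq T) (@BOr T).
Proof. by move=> b b' hb c c' hc; exact: ba_or. Qed.
#[export] Instance BNot_Proper T : Proper (@ba_eq T ==> @ba_eq T) (@BNot T).
Proof. by move=> b b' hb; exact: ba_not. Qed.

#[export] Hint Resolve ba_refl : core.

Section BooleanAlgebra.
Variable T : Type.
Implicit Types b c d : bexp T.
Local Open Scope bexp_scope.

Lemma ba_1and b : 1 * b =BA b.
Proof. by rewrite ba_andC ba_and1. Qed.

Lemma ba_0or b : 0 + b =BA b.
Proof. by rewrite ba_orC ba_or0. Qed.

Lemma ba_and_idem b : b * b =BA b.
Proof.
by rewrite -{3}(ba_and1 b) -(ba_orN b) ba_andDr ba_andN ba_or0.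
Qed.

Lemma ba_or_idem b : b + b =BA b.
Proof.
by rewrite -{3}(ba_or0 b) -(ba_andN b) ba_orDr ba_orN ba_and1.
Qed.

Lemma ba_and0 b : b * 0 =BA 0.
Proof. by rewrite -{1}(ba_andN b) ba_andA ba_and_idem ba_andN. Qed.

Lemma ba_0and b : 0 * b =BA 0.
Proof. by rewrite ba_andC ba_and0. Qed.

Lemma ba_or1 b : b + 1 =BA 1.
Proof. by rewrite -{1}(ba_orN b) ba_orA ba_or_idem ba_orN. Qed.

Lemma ba_orK b c : b + b * c =BA b.
Proof. by rewrite -{1}(ba_and1 b) -ba_andDr (ba_orC 1) ba_or1 ba_and1. Qed.

Lemma ba_andK b c : b * (b + c) =BA b.
Proof. by rewrite ba_andDr ba_and_idem ba_orK. Qed.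

Lemma ba_leP b c : ba_le b c <-> b * c =BA b.
Proof.
rewrite /ba_le; split=> h; first by rewrite -h ba_andK.
by rewrite -h ba_orC (ba_andC b c) ba_orK.
Qed.

Lemma ba_and_split b c : b =BA b * c + b * ~` c.
Proof. by rewrite -ba_andDr ba_orN ba_and1. Qed.

Lemma ba_and_neg b c : b * c =BA 0 -> b * ~` c =BA b.
Proof. by move=> h; rewrite {2}(ba_and_split b c) h ba_0or. Qed.

Lemma ba_classP b c : ba_class b = ba_class c <-> b =BA c.
Proof.
rewrite /ba_class; split=> [/eqmodP/asboolP //|h].
by apply/eqmodP/asboolP.
Qed.

Lemma repr_ba_class b : repr (ba_class b) =BA b.
Proof. by apply/ba_classP; rewrite /ba_class reprK. Qed.

Lemma ba_class_repr (x : freeBA T) : ba_class (repr x) = x.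
Proof. by rewrite /ba_class reprK. Qed.

Definition formula (a : atom T) : bexp T := repr (val a).

(** The two-valued valuation attached to an atom: minimality makes [holds a] commute with all
    Boolean operators. *)
Definition holds (a : atom T) b : bool := `[< atom_le a b >].

Lemma holdsP a b : reflect (formula a * b =BA formula a) (holds a b).
Proof.
apply: (iffP (asboolP _)) => [/ba_leP|]; rewrite /formula ?repr_ba_class //.
by move=> h; apply/ba_leP; rewrite repr_ba_class.
Qed.

Lemma formula_neq0 a : ~ formula a =BA 0.
Proof.
case/asboolP: (valP a) => + _ h; apply.
by rewrite -(ba_class_repr (val a)); apply/ba_classP.
Qed.

(** The product lies below the atom [a], so by minimality it is zero or the atom itself. *)
Lemma formula_and a b :
  formula a * b =BA (if holds a b then formula a else 0).
Proof.
case: ifPn => [/holdsP //|/holdsP hN].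
case/asboolP: (valP a) => _ /(_ (ba_class (formula a * b))) [||].
- apply/ba_leP; rewrite repr_ba_class -/(formula a) (ba_andC _ (formula a)).
  by rewrite ba_andA ba_and_idem.
- by move/ba_classP.
- by rewrite -[RHS]ba_class_repr => /ba_classP.
Qed.

Lemma holds_congr a b c : b =BA c -> holds a b = holds a c.
Proof. by move=> h; apply/holdsP/holdsP; rewrite h. Qed.

Lemma holds0 a : holds a 0 = false.
Proof.
by apply/holdsP; rewrite ba_and0 => /ba_sym; exact: formula_neq0.
Qed.

Lemma holds1 a : holds a 1.
Proof. by apply/holdsP; rewrite ba_and1. Qed.

Lemma holds_and a b c : holds a (b * c) = holds a b && holds a c.
Proof.
have h : formula a * (b * c) =BA
    if holds a b && holds a c then formula a else 0.
  rewrite ba_andA formula_and; case: ifP => //= _; last exact: ba_0and.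
  exact: formula_and.
apply/holdsP/idP; rewrite h; case: ifP => // _ /ba_sym h0.
by case: (@formula_neq0 a).
Qed.

Lemma holds_or a b c : holds a (b + c) = holds a b || holds a c.
Proof.
have h : formula a * (b + c) =BA
    if holds a b || holds a c then formula a else 0.
  rewrite ba_andDr !formula_and.
  by do 2!case: ifP => //= _; rewrite ?ba_or0 ?ba_0or ?ba_or_idem.
apply/holdsP/idP; rewrite h; case: ifP => // _ /ba_sym h0.
by case: (@formula_neq0 a).
Qed.

Lemma holds_not a b : holds a (~` b) = ~~ holds a b.
Proof.
have := holds_congr a (ba_andN b); have := holds_congr a (ba_orN b).
rewrite holds_and holds_or holds0 holds1.
by case: (holds a b); case: (holds a _).
Qed.

Definition holdsE := (holds0, holds1, holds_and, holds_or, holds_not).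

Lemma holds_formula a a' : holds a (formula a') = (a == a').
Proof.
apply/holdsP/eqP => [h|->]; last exact: ba_and_idem.
case/asboolP: (valP a') => _ /(_ (val a)) [||/val_inj //].
- by apply/ba_leP.
- rewrite -[LHS]ba_class_repr => /ba_classP h0.
  by case: (@formula_neq0 a).
Qed.

End BooleanAlgebra.

(** * Finiteness of the atoms, and extensionality of tests *)

Section Atoms.
Variable T : finType.
Implicit Types (b c : bexp T) (a : atom T).
Local Open Scope bexp_scope.

Definition big_or (s : seq (bexp T)) : bexp T := foldr (@BOr T) 0 s.

Lemma big_or_cat s1 s2 : big_or (s1 ++ s2) =BA big_or s1 + big_or s2.
Proof.
elim: s1 => [|b s1 IH] /=; first by rewrite ba_0or.
by rewrite IH ba_orA.
Qed.

Lemma big_or_and c s : big_or [seq c * b | b <- s] =BA c * big_or s.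
Proof.
elim: s => [|b s IH] /=; first by rewrite ba_and0.
by rewrite IH ba_andDr.
Qed.

Fixpoint minterms (s : seq T) : seq (bexp T) :=
  if s is t :: s' then
    [seq BPrim t * m | m <- minterms s'] ++
    [seq ~` BPrim t * m | m <- minterms s']
  else [:: 1].

Lemma big_or_minterms s : big_or (minterms s) =BA 1.
Proof.
elim: s => [|t s IH] /=; first by rewrite ba_or0.
rewrite big_or_cat !big_or_and IH !ba_and1; exact: ba_orN.
Qed.

Lemma minterm_prim s t m :
  t \in s -> m \in minterms s -> m * BPrim t =BA m \/ m * BPrim t =BA 0.
Proof.
elim: s m => // u s IH m; rewrite inE mem_cat.
have [-> _|ne /= ts] := eqVneq t u.
  case/orP => /mapP[m' _ ->]; [left|right].
    by rewrite ba_andC ba_andA ba_and_idem.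
  by rewrite ba_andC ba_andA ba_andN ba_0and.
by case/orP => /mapP[m' /(IH _ ts) h ->]; case: h => h; [left|right|left|right];
  rewrite -ba_andA h ?ba_and0.
Qed.

Lemma minterm_and m b :
  m \in minterms (enum T) -> m * b =BA m \/ m * b =BA 0.
Proof.
move=> hm; elim: b => [||t|b [hb|hb] c [hc|hc]|b [hb|hb] c [hc|hc]|b [hb|hb]].
- by right; exact: ba_and0.
- by left; exact: ba_and1.
- by apply: minterm_prim hm; rewrite mem_enum.
- by left; rewrite ba_andA hb.
- by right; rewrite ba_andA hb.
- by right; rewrite ba_andA hb ba_0and.
- by right; rewrite ba_andA hb ba_0and.
- by left; rewrite ba_andDr hb hc ba_or_idem.
- by left; rewrite ba_andDr hb hc ba_or0.
- by left; rewrite ba_andDr hb hc ba_0or.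
- by right; rewrite ba_andDr hb hc ba_or0.
- by right; rewrite -hb -ba_andA ba_andN ba_and0.
- by left; exact: ba_and_neg.
Qed.

(** A minterm decides every expression, so anything below it, being its product with the minterm, is
    zero or the minterm. *)
Lemma minterm_atom m :
  m \in minterms (enum T) -> ~ m =BA 0 -> is_atom (ba_class m).
Proof.
move=> hm h0; split=> [/ba_classP //|y /ba_leP].
rewrite repr_ba_class ba_andC => h.
case: (minterm_and (repr y) hm) => h'; [right|left];
  by rewrite -[LHS]ba_class_repr; apply/ba_classP; rewrite -h.
Qed.

(* Minterms are in fact never zero; discarding those that would be spares us
   the proof of it. *)
Definition atoms : seq (atom T) :=
  pmap insub [seq ba_class m | m <- minterms (enum T)].

Lemma big_or_atoms : big_or [seq formula a | a <- atoms] =BA 1.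
Proof.
rewrite /atoms -(big_or_minterms (enum T)).
(* The induction runs over the list that is summed, while the right-hand side of the inclusion stays
   the full list of minterms, so that [minterm_atom] keeps applying. *)
have : {subset minterms (enum T) <= minterms (enum T)} by [].
elim: {1 3 4}(minterms _) => //= m s IH sub.
have {}IH := IH (fun x xs => sub x (mem_behead (s := m :: s) xs)).
have hm := sub m (mem_head m s).
case: insubP => [a _ ha|/asboolP nat] /=.
  by rewrite IH /formula ha repr_ba_class.
rewrite IH; have [->|h0] := pselect (m =BA 0); first by rewrite ba_0or.
by case: nat; exact: minterm_atom.
Qed.

Lemma holds_big_or a s : holds a (big_or s) = has (holds a) s.
Proof. by elim: s => [|b s IH] /=; rewrite ?holdsE // IH. Qed.

Lemma mem_atoms a : a \in atoms.
Proof.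
have := holds_congr a big_or_atoms; rewrite holds1 holds_big_or has_map.
by case/hasP => a' a'in /=; rewrite holds_formula => /eqP ->.
Qed.

(** Both sides are multiplied by 1, written as the sum of all atoms; each summand is then determined
    by [holds]. *)
Lemma ba_ext b c : (forall a, holds a b = holds a c) -> b =BA c.
Proof.
move=> h; rewrite -(ba_1and b) -(ba_1and c) -big_or_atoms.
elim: atoms => [|a s IH] /=; first by rewrite !ba_0and.
rewrite !(ba_andC (_ + _)) !ba_andDr -!(ba_andC (big_or _)) IH.
by rewrite !(ba_andC _ (formula a)) !formula_and h.
Qed.

(** Since there are finitely many atoms, every set of atoms is cut out by a test. *)
Definition test_of (P : pred (atom T)) : bexp T :=
  big_or [seq formula a | a <- atoms & P a].

Lemma holds_test_of a P : holds a (test_of P) = P a.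
Proof.
rewrite holds_big_or has_map; apply/hasP/idP => [[a'] | Pa].
  by rewrite mem_filter /= holds_formula => /andP[Pa' _] /eqP ->.
by exists a; rewrite ?mem_filter ?Pa ?mem_atoms //= holds_formula.
Qed.

End Atoms.

(** Boolean identities by truth table at an arbitrary atom. *)
Ltac ba_tac :=
  apply: ba_ext => ?; rewrite !holdsE;
  repeat (match goal with |- context [holds ?a ?b] => case: (holds a b) end);
  done.

(** * Equational reasoning restricted to an atom *)

#[export] Instance gkat_eq_Equivalence Sigma T :
  Equivalence (@gkat_eq Sigma T).
Proof. by split; [exact: geq_refl|exact: geq_sym|exact: geq_trans]. Qed.
#[export] Instance Seq_Proper Sigma T :
  Proper (@gkat_eq Sigma T ==> @gkat_eq Sigma T ==> @gkat_eq Sigma T)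
         (@Seq Sigma T).
Proof. by move=> e e' he f f' hf; exact: geq_seq. Qed.
#[export] Instance Cond_Proper Sigma T :
  Proper (@gkat_eq Sigma T ==> @ba_eq T ==> @gkat_eq Sigma T ==>
          @gkat_eq Sigma T) (@Cond Sigma T).
Proof.
by move=> e e' he b b' hb f f' hf; apply: geq_cond => //; exact: geq_BA.
Qed.
#[export] Instance Loop_Proper Sigma T :
  Proper (@gkat_eq Sigma T ==> @ba_eq T ==> @gkat_eq Sigma T) (@Loop Sigma T).
Proof.
by move=> e e' he b b' hb; apply: geq_loop => //; exact: geq_BA.
Qed.
#[export] Instance Test_Proper Sigma T :
  Proper (@ba_eq T ==> @gkat_eq Sigma T) (@Test Sigma T).
Proof. by move=> b b' hb; exact: geq_BA. Qed.

#[export] Hint Resolve geq_refl : core.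

HB.instance Definition _ (Sigma T : Type) := gen_eqMixin (exp Sigma T).

Section Restriction.
Variables (Sigma : Type) (T : finType).
Implicit Types (e f g : exp Sigma T) (b c : bexp T) (a : atom T).
Local Open Scope gkat_scope.

Lemma test_test b c e : [? b] * ([? c] * e) == [? b * c] * e.
Proof. by rewrite -geq_S1 -geq_and. Qed.

Lemma cond_test_r e b f : e +[b] f == e +[b] [? ~` b] * f.
Proof.
rewrite geq_U2 geq_U4 geq_U2.
by have -> : (~` (~` b) =BA b) by ba_tac.
Qed.

(** (U1) splits the right side into two equal branches; in the second one the test contradicts the
    guard. *)
Lemma cond0 e b : e +[b] [? 0] == [? b] * e.
Proof.
rewrite -(geq_U1 ([? b] * e) b) (cond_test_r ([? b] * e)) -geq_U4 test_test.
have -> : (~` b * b =BA 0) by ba_tac.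
by rewrite geq_S2.
Qed.

(** By [cond0] the leading test is itself a conditional, so (U3) merges the two guards and leaves
    [f] under contradictory tests. *)
Lemma test_cond_l e b f : [? b] * (e +[b] f) == [? b] * e.
Proof.
rewrite -!cond0 geq_U3 (cond0 f) cond_test_r test_test.
have -> : (~` (b * b) * b =BA 0) by ba_tac.
rewrite geq_S2.
by have -> : (b * b =BA b) by ba_tac.
Qed.

Lemma test_cond_r e b f : [? ~` b] * (e +[b] f) == [? ~` b] * f.
Proof. by rewrite geq_U2 test_cond_l. Qed.

Lemma test_case b e f :
  [? b] * e == [? b] * f -> [? ~` b] * e == [? ~` b] * f -> e == f.
Proof.
move=> h1 h2; rewrite -(geq_U1 e b) geq_U4 cond_test_r h1 h2.
by rewrite -cond_test_r -geq_U4 geq_U1.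
Qed.

Definition at_atom a e : exp Sigma T := [? formula a] * e.

#[export] Instance at_atom_Proper a :
  Proper (@gkat_eq Sigma T ==> @gkat_eq Sigma T) (at_atom a).
Proof. by move=> e f h; rewrite /at_atom h. Qed.

Lemma at_atom_seq a e f : at_atom a (e * f) == at_atom a e * f.
Proof. by rewrite /at_atom geq_S1. Qed.

Lemma at_atom_test a b :
  at_atom a [? b] == at_atom a (if holds a b then [? 1] else [? 0]).
Proof.
rewrite /at_atom -geq_and formula_and; case: ifP => _.
  by rewrite geq_S5.
by rewrite geq_S3.
Qed.

Lemma at_atom_test_seq a b e :
  at_atom a ([? b] * e) == at_atom a (if holds a b then e else [? 0]).
Proof.
rewrite /at_atom test_test formula_and; case: ifP => _ //.
by rewrite geq_S2 geq_S3.
Qed.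

(** Any test satisfied by [a] can be inserted after [formula a]; inserting [b] or its negation
    selects the branch. *)
Lemma at_atom_cond a e b f :
  at_atom a (e +[b] f) == at_atom a (if holds a b then e else f).
Proof.
case: ifP => hb.
  have h g : at_atom a g == at_atom a ([? b] * g).
    by rewrite at_atom_test_seq hb.
  by rewrite h test_cond_l -h.
have h g : at_atom a g == at_atom a ([? ~` b] * g).
  by rewrite at_atom_test_seq holdsE hb.
by rewrite h test_cond_r -h.
Qed.

(** The atoms sum to 1, and [test_case] splits them off one at a time. *)
Lemma atom_ext e f : (forall a, at_atom a e == at_atom a f) -> e == f.
Proof.
move=> h; rewrite -(geq_S4 e) -(geq_S4 f) -big_or_atoms.
elim: (atoms T) => [|a s IH] /=; first by rewrite !geq_S2.
apply: (@test_case (formula a)); rewrite !test_test.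
  have -> : (formula a * (formula a + big_or [seq formula a | a <- s])
             =BA formula a) by ba_tac.
  exact: h.
have -> : (~` formula a * (formula a + big_or [seq formula a | a <- s])
   =BA ~` formula a * big_or [seq formula a | a <- s]) by ba_tac.
by rewrite -!test_test IH.
Qed.

End Restriction.

(** * Finite automata as Salomaa systems, and the resulting coinduction principle *)

Inductive outcome (Sigma X : Type) :=
| Reject
| Accept
| Step of Sigma & X.
Arguments Reject {Sigma X}.
Arguments Accept {Sigma X}.
Arguments Step {Sigma X}.

Definition run Sigma T X (s : X -> exp Sigma T) (r : outcome Sigma X) :
    exp Sigma T :=
  match r with
  | Reject => [? 0]
  | Accept => [? 1]
  | Step p x => Act p * s x
  end%G.

Section Uniqueness.
Variables (Sigma : Type) (T : finType).
Implicit Types (a : atom T).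

Section System.
Variables (n : nat) (tr : 'I_n -> atom T -> outcome Sigma 'I_n).

Definition steps_to i j : pred (atom T) :=
  fun a => if tr i a is Step _ k then k == j else false.

Definition accepts i : pred (atom T) :=
  fun a => if tr i a is Accept then true else false.

(** One coefficient serves a whole row: it performs the action prescribed at the current atom, and
    the guard of each column already restricts to the atoms leading there. Every branch is an action
    or 0, whence the Salomaa condition. *)
Definition letters i : exp Sigma T :=
  foldr (fun a f =>
    (if tr i a is Step p _ then Act p else [? 0]) +[formula a] f)%G
  [? 0]%G (atoms T).

Fact steps_to_disj i j k :
  j != k -> (test_of (steps_to i j) * test_of (steps_to i k)) =BA 0.
Proof.
move=> jk; apply: ba_ext => a; rewrite !holdsE !holds_test_of /steps_to.
by case: (tr i a) => // _ x; case: eqVneq => // ->; exact: negbTE.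
Qed.

Fact steps_to_accepts_disj i j :
  (test_of (steps_to i j) * test_of (accepts i)) =BA 0.
Proof.
apply: ba_ext => a; rewrite !holdsE !holds_test_of /steps_to /accepts.
by case: (tr i a) => // *; rewrite andbF.
Qed.

Definition automaton_system : affine_system Sigma T n :=
  @AffineSystem Sigma T n (fun i _ => letters i)
    (fun i j => test_of (steps_to i j)) (fun i => test_of (accepts i))
    steps_to_disj steps_to_accepts_disj.

Lemma automaton_system_salomaa :
  is_salomaa (@gkat_eq Sigma T) automaton_system.
Proof.
move=> i ?; apply: geq_BA; rewrite /= /letters.
elim: (atoms T) => //= a s IH; rewrite IH.
by case: (tr i a) => [||p k] /=; rewrite !ba_and0 ba_or0.
Qed.

Lemma at_atom_letters i a p k :
  tr i a = Step p k -> (at_atom a (letters i) == at_atom a (Act p))%G.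
Proof.
move=> h; rewrite /letters; have := mem_atoms a.
elim: (atoms T) => //= a' s IH; rewrite inE at_atom_cond holds_formula.
by case: eqVneq => [<- _|_ /IH //]; rewrite h.
Qed.

(** If [i] steps to [k] at [a], only the guard of column [k] holds at [a]. Otherwise every guard
    fails and the constant term decides between acceptance and rejection. *)
Lemma at_atom_affine_rhs (s : 'I_n -> exp Sigma T) i a :
  (at_atom a (affine_rhs automaton_system s i) ==
   at_atom a (run s (tr i a)))%G.
Proof.
rewrite /affine_rhs /=.
have [[p [k trE]]|nstep] := pselect (exists p k, tr i a = Step p k).
  have := mem_enum 'I_n k; rewrite inE.
  elim: (enum 'I_n) => //= j l IH; rewrite inE at_atom_cond holds_test_of.
  rewrite {1}/steps_to trE; case: eqVneq => [<- _ /=|_ /IH]; last by rewrite trE.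
  by rewrite at_atom_seq (at_atom_letters trE) -at_atom_seq.
elim: (enum 'I_n) => [|j l IH] /=.
  rewrite at_atom_test holds_test_of /accepts.
  by case trE: (tr i a) => [||p k] //; case: nstep; exists p, k.
rewrite at_atom_cond holds_test_of {1}/steps_to.
by case trE: (tr i a) IH => [||p k] //; case: nstep; exists p, k.
Qed.

Lemma automaton_unique (s s' : 'I_n -> exp Sigma T) :
  (forall i a, at_atom a (s i) == at_atom a (run s (tr i a)))%G ->
  (forall i a, at_atom a (s' i) == at_atom a (run s' (tr i a)))%G ->
  forall i, (s i == s' i)%G.
Proof.
move=> hs hs'; apply: (geq_UA automaton_system_salomaa) => i;
  by apply: atom_ext => a; rewrite at_atom_affine_rhs.
Qed.

End System.

Definition step_in (X : Type) (P : X -> Prop) (r : outcome Sigma X) : Prop :=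
  if r is Step _ x then P x else True.

Lemma coinduction (P : seq (exp Sigma T * exp Sigma T)) :
  (forall x a, x \in P -> exists r,
     [/\ step_in (fun y => y \in P) r,
         (at_atom a x.1 == at_atom a (run fst r))%G
       & (at_atom a x.2 == at_atom a (run snd r))%G]) ->
  forall e f, (e, f) \in P -> (e == f)%G.
Proof.
move=> hP; suff h x : x \in P -> (x.1 == x.2)%G by move=> e f /h.
move=> xP.
pose x_ (i : 'I_(size P)) := tnth (in_tuple P) i.
(* Transitions between pairs become transitions between positions in [P]; for a repeated pair any of
   its positions will do. *)
have /choice[tr htr] : forall ia : 'I_(size P) * atom T, exists r,
    (at_atom ia.2 (x_ ia.1).1 == at_atom ia.2 (run (fst \o x_) r))%G /\
    (at_atom ia.2 (x_ ia.1).2 == at_atom ia.2 (run (snd \o x_) r))%G.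
  case=> i a /=; have [|[||p y] [/= hr h1 h2]] := hP (x_ i) a.
  - exact: mem_tnth.
  - by exists Reject.
  - by exists Accept.
  - have /tnthP[j yE] : y \in in_tuple P by [].
    by exists (Step p j); rewrite /= /x_ -yE.
have /tnthP[i ->] : x \in in_tuple P by [].
apply: (@automaton_unique _ (fun i a => tr (i, a)) (fst \o x_) (snd \o x_)).
  by move=> j a; case: (htr (j, a)).
by move=> j a; case: (htr (j, a)).
Qed.

End Uniqueness.

(** * Brzozowski derivatives and their finiteness *)

Section Derivative.
Variables (Sigma : Type) (T : finType).
Implicit Types (e f g : exp Sigma T) (a b : atom T).

(** A loop whose guard holds but whose body accepts without acting would spin forever at [a]; it
    therefore rejects. *)
Fixpoint deriv e a : outcome Sigma (exp Sigma T) :=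
  match e with
  | Act p => Step p [? 1]%G
  | Test c => if holds a c then Accept else Reject
  | Seq e f =>
      match deriv e a with
      | Reject => Reject
      | Accept => deriv f a
      | Step p e' => Step p (e' * f)%G
      end
  | Cond e c f => if holds a c then deriv e a else deriv f a
  | Loop e c =>
      if holds a c then
        if deriv e a is Step p e' then Step p (e' * e ^[c])%G else Reject
      else Accept
  end.

Lemma at_atom_deriv e a : (at_atom a e == at_atom a (run id (deriv e a)))%G.
Proof.
elim: e => [p|c|e IHe f IHf|e IHe c f IHf|e IH c] /=.
- by rewrite geq_S5.
- by rewrite at_atom_test; case: (holds a c).
- rewrite at_atom_seq IHe -at_atom_seq.
  case: (deriv e a) => [||p e'] /=; first by rewrite geq_S2.
    by rewrite geq_S4.
  by rewrite geq_S1.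
- by rewrite at_atom_cond; case: (holds a c).
case hc: (holds a c); last by rewrite geq_W1 at_atom_cond hc.
(* One unrolling settles the loop unless the body accepts at [a]: then the right side is the loop
   itself preceded by 1, and nothing is gained. *)
have loopE : (at_atom a (e ^[c]) ==
    at_atom a (run id (deriv e a) * e ^[c]))%G.
  by rewrite {1}geq_W1 at_atom_cond hc at_atom_seq IH -at_atom_seq.
case: (deriv e a) IH loopE => [||p e'] /= IH loopE.
- by rewrite loopE geq_S2.
- (* The body accepts [a] without acting: (W2) removes [a] from its domain. *)
  have eE : (e == e +[~` formula a] [? 1])%G.
    apply: atom_ext => b; rewrite at_atom_cond holdsE holds_formula.
    by case: eqVneq => [->|].
  rewrite eE geq_W2 geq_W1 at_atom_cond hc geq_S1 at_atom_test_seq.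
  by rewrite holdsE holds_formula eqxx.
- by rewrite loopE geq_S1.
Qed.

(** A finite list closed under [deriv], possibly with unreachable members. It stays finite because
    steps inside a product or a loop body only change the left factor. *)
Fixpoint derivs e : seq (exp Sigma T) :=
  match e with
  | Act p => [:: e; [? 1]%G]
  | Test c => [:: e]
  | Seq e f => [seq (e' * f)%G | e' <- derivs e] ++ derivs f
  | Cond e1 c f1 => e :: derivs e1 ++ derivs f1
  | Loop e1 c => e :: [seq (e' * e)%G | e' <- derivs e1]
  end.

Lemma mem_derivs e : e \in derivs e.
Proof.
elim: e => [p|c|e IHe f IHf|e IHe c f IHf|e IH c] /=; rewrite ?inE ?eqxx //.
by rewrite mem_cat map_f.
Qed.

Lemma derivs_step e e' a p g :
  e' \in derivs e -> deriv e' a = Step p g -> g \in derivs e.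
Proof.
elim: e e' p g => [q|c|e IHe f IHf|e IHe c f IHf|e IH c] e' p g /=.
- rewrite !inE => /orP[] /eqP -> /=; first by case=> _ <-; rewrite eqxx orbT.
  by case: ifP.
- by rewrite inE => /eqP -> /=; case: ifP.
- rewrite !mem_cat => /orP[/mapP[e1 e1in ->] /=|/IHf h /h -> //]; last first.
    by rewrite orbT.
  case he1: (deriv e1 a) => [||q e2] //.
    (* The left factor accepts, so the step is one made by [f] itself. *)
    by move/(IHf _ _ _ (mem_derivs f)) => ->; rewrite orbT.
  by case=> _ <-; rewrite map_f //; exact: IHe he1.
- rewrite !inE !mem_cat => /or3P[/eqP -> /=|/IHe h /h ->|/IHf h /h ->];
    rewrite ?orbT //.
  by case: ifP => _ => [/(IHe _ _ _ (mem_derivs e))|/(IHf _ _ _ (mem_derivs f))]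
    ->; rewrite ?orbT.
- rewrite !inE => /orP[/eqP -> /=|/mapP[e1 e1in ->] /=].
    case: ifP => // _; case he: (deriv e a) => [||q e2] // [_ <-].
    by rewrite map_f ?orbT //; apply: IH he; exact: mem_derivs.
  (* If [e1] accepts, control returns to the head of the loop and the step is one made by the loop
     itself. *)
  case he1: (deriv e1 a) => [||q e2] //.
    case: ifP => // _; case he: (deriv e a) => [||q e2] // [_ <-].
    by rewrite map_f ?orbT //; apply: IH he; exact: mem_derivs.
  by case=> _ <-; rewrite map_f ?orbT //; exact: IH he1.
Qed.

End Derivative.

(** * The language of an expression, read off its derivatives *)

Section Semantics.
Variables (Sigma : Type) (T : finType).
Implicit Types (L K M : set (gs Sigma T)) (B : set (atom T)) (a b : atom T).
Implicit Types (w : seq (Sigma * atom T)) (e f g : exp Sigma T).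
Local Open Scope classical_set_scope.

Lemma lfusionP L K a w :
  lfusion L K (a, w) <->
  exists w1 w2, [/\ w = w1 ++ w2, L (a, w1) & K (gs_last (a, w1), w2)].
Proof.
split=> [[[a1 w1] [[a2 w2] [Lx Ky]]]|[w1 [w2 [-> Lx Ky]]]].
  rewrite /gs_fusion; case: eqP => //= ax [<- <-].
  by exists w1, w2; rewrite ax.
by exists (a, w1), (gs_last (a, w1), w2); rewrite /gs_fusion eqxx.
Qed.

Lemma gs_last_cat a w1 w2 :
  gs_last (a, w1 ++ w2) = gs_last (gs_last (a, w1), w2).
Proof. by rewrite /gs_last /= /unzip2 map_cat last_cat. Qed.

Lemma lfusionA L K M : lfusion L (lfusion K M) = lfusion (lfusion L K) M.
Proof.
apply/seteqP; split=> -[a w] /lfusionP.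
  move=> [w1 [w23 [-> Lx /lfusionP[w2 [w3 [-> Ky Mz]]]]]].
  apply/lfusionP; exists (w1 ++ w2), w3; rewrite catA gs_last_cat; split=> //.
  by apply/lfusionP; exists w1, w2.
move=> [w12 [w3 [-> /lfusionP[w1 [w2 [-> Lx Ky]]] Mz]]].
apply/lfusionP; exists w1, (w2 ++ w3); rewrite catA; split=> //.
by apply/lfusionP; exists w2, w3; rewrite -gs_last_cat.
Qed.

Lemma lfusion_latoms_l B L a w :
  lfusion (latoms B) L (a, w) <-> B a /\ L (a, w).
Proof.
split=> [/lfusionP[w1 [w2 [-> [b Bb [-> ->]] //]]]|[Ba Lw]].
by apply/lfusionP; exists [::], w; split=> //; exists a.
Qed.

Lemma lfusion_setT_l L : lfusion (latoms setT) L = L.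
Proof.
by apply/seteqP; split=> -[a w]; [move=> /lfusion_latoms_l[]|
  move=> ?; apply/lfusion_latoms_l].
Qed.

Lemma lfusion_setT_r L : lfusion L (latoms setT) = L.
Proof.
apply/seteqP; split=> -[a w].
  by move=> /lfusionP[w1 [w2 [-> Lw [b _ [_ ->]]]]]; rewrite cats0.
move=> Lw; apply/lfusionP; exists w, [::]; rewrite cats0; split=> //.
by exists (gs_last (a, w)).
Qed.

(** [lpow] appends factors on the right, whereas derivatives consume a guarded string from the
    left. *)
Lemma lpowSl L n : lpow L n.+1 = lfusion L (lpow L n).
Proof.
elim: n => [|n IH]; first by rewrite /= lfusion_setT_l lfusion_setT_r.
by rewrite -[LHS]/(lfusion (lpow L n.+1) L) {1}IH -lfusionA.
Qed.

Lemma lloop_stop L B a : ~ B a -> lloop L B (a, [::]).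
Proof.
move=> nBa; exists 0%N => //=; apply/lfusion_latoms_l; split=> //.
by exists a.
Qed.

Lemma lloop_step L B a w1 w2 :
  B a -> L (a, w1) -> lloop L B (gs_last (a, w1), w2) ->
  lloop L B (a, w1 ++ w2).
Proof.
move=> Ba Lw [n _ hn]; exists n.+1 => //; rewrite lpowSl -lfusionA.
apply/lfusionP; exists w1, w2; split=> //.
by apply/lfusion_latoms_l.
Qed.

(** Together with [lloop_stop] and [lloop_step], this presents the loop language as an inductively
    defined set. *)
Lemma lloop_ind L B (P : gs Sigma T -> Prop) :
  (forall a, ~ B a -> P (a, [::])) ->
  (forall a w1 w2, B a -> L (a, w1) -> lloop L B (gs_last (a, w1), w2) ->
     P (gs_last (a, w1), w2) -> P (a, w1 ++ w2)) ->
  forall z, lloop L B z -> P z.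
Proof.
move=> hstop hstep z [n _]; elim: n z => [|n IH] [a w].
  by move=> /lfusion_latoms_l[_ [b nBb [-> ->]]]; exact: hstop.
rewrite lpowSl -lfusionA => /lfusionP[w1 [w2 [-> /lfusion_latoms_l[Ba Lw] hn]]].
by apply: hstep => //; [exists n|exact: IH].
Qed.

Definition lang_spec e (x : gs Sigma T) : Prop :=
  match x.2 with
  | [::] => deriv e x.1 = Accept
  | (p, b) :: w => exists2 e', deriv e x.1 = Step p e' & lang e' (b, w)
  end.

Lemma atoms_belowP a c : atoms_below c a <-> holds a c.
Proof. by split=> /asboolP. Qed.

Lemma lang_cond e c f a w :
  lang (e +[c] f)%G (a, w) <-> (if holds a c then lang e else lang f) (a, w).
Proof.
rewrite /= /lcond; case: ifPn => hc; split.
- by case=> /lfusion_latoms_l[// /atoms_belowP]; rewrite hc.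
- by move=> h; left; apply/lfusion_latoms_l; split=> //; exact/atoms_belowP.
- by case=> /lfusion_latoms_l[// /atoms_belowP]; rewrite (negbTE hc).
- move=> h; right; apply/lfusion_latoms_l; split=> // /atoms_belowP.
  exact/negP.
Qed.

Lemma lang_deriv e x : lang e x <-> lang_spec e x.
Proof.
case: x => a w; elim: e a w => [p|c|e IHe f IHf|e IHe c f IHf|e IH c] a w.
- split=> [[a' [b [-> ->]]]|].
    by exists [? 1]%G => //; exists b => //; apply/atoms_belowP/holds1.
  case: w => [|[q b] w] // [_ [-> <-] [b' _ [_ ->]]].
  by exists a, b.
- rewrite /lang_spec; split=> [[b /atoms_belowP hb [-> ->]] /=|/=].
    by rewrite hb.
  case: w => [|[q b] w] /=; last by case: ifP => _ [].
  by case: ifP => // hc _; exists a => //; exact/atoms_belowP.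
- split=> [/lfusionP[w1 [w2 [-> /IHe]]]|].
    case: w1 => [|[p b] w1] /=; rewrite /lang_spec /=.
      by move=> -> /IHf.
    move=> [e' -> he'] hf; exists (e' * f)%G => //.
    by apply/lfusionP; exists w1, w2.
  rewrite /lang_spec /= => h; apply/lfusionP.
  case he: (deriv e a) h => [||p e'] h.
  + by case: w h => [|[p b] w] // [].
  + by exists [::], w; split=> //; [apply/IHe|apply/IHf].
  + case: w h => [|[q b] w] // [_ [<- <-] /lfusionP[w1 [w2 [-> he' hf]]]].
    exists ((p, b) :: w1), w2; split=> //; apply/IHe.
    by exists e'.
- rewrite lang_cond /lang_spec /=.
  by case: ifP => _; [exact: IHe|exact: IHf].
split=> [|h].
  move: (a, w) => z {a w}; apply: lloop_ind => [a|a w1 w2].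
    by move=> /atoms_belowP/negP/negbTE hc; rewrite /lang_spec /= hc.
  (* An iteration that performs no action leaves both the atom and the remaining string unchanged,
     so the induction hypothesis is already the goal. *)
  move=> /atoms_belowP hc; case: w1 => [|[p b] w1] //.
  move=> /IH[e' he he'] hl _; rewrite /lang_spec /= hc he.
  by exists (e' * e ^[c])%G => //; apply/lfusionP; exists w1, w2.
move: h; rewrite /lang_spec /=; case: ifPn => hc; last first.
  case: w => [_|[p b] w []//].
  apply: lloop_stop => /atoms_belowP; exact/negP.
case: w => [|[p b] w]; case he: (deriv e a) => [||q e'] //; try by case.
case=> _ [<- <-] /lfusionP[w1 [w2 [-> he' hl]]].
apply: (@lloop_step _ _ a ((q, b) :: w1) w2) => //; first exact/atoms_belowP.
by apply/IH; exists e'.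
Qed.

Lemma lang_step e a p e' b w :
  deriv e a = Step p e' -> lang e' (b, w) <-> lang e (a, (p, b) :: w).
Proof.
move=> he; rewrite (lang_deriv e) /lang_spec /= he.
by split=> [h|[_ [<-]]//]; exists e'.
Qed.

End Semantics.

(** * Dead expressions and completeness *)

Section Completeness.
Variables (Sigma : Type) (T : finType).
Implicit Types (e f : exp Sigma T) (a : atom T).
Local Open Scope classical_set_scope.

Lemma lang_eq0 e : lang e = set0 -> (e == [? 0])%G.
Proof.
pose P : seq (exp Sigma T * exp Sigma T) :=
  [seq (e', [? 0]%G) | e' <- derivs e & `[< lang e' = set0 >]].
move=> e0; apply: (@coinduction _ _ P); last first.
  by rewrite map_f // mem_filter mem_derivs andbT; apply/asboolP.
move=> x a /mapP[f]; rewrite mem_filter => /andP[/asboolP f0 fin] ->.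
case hf: (deriv f a) => [||p f'].
- by exists Reject; split=> //; rewrite at_atom_deriv hf.
- have : lang f (a, [::]) by apply/lang_deriv.
  by rewrite f0.
(* The component 0 can imitate any step, since [Act p * [? 0]] equals 0 by (S3). *)
exists (Step p (f', [? 0]%G)); split=> /=.
- apply/map_f; rewrite mem_filter (derivs_step fin hf) andbT.
  apply/asboolP/seteqP; split=> // -[b w] /(lang_step _ _ hf).
  by rewrite f0.
- by rewrite at_atom_deriv hf.
- by rewrite geq_S3.
Qed.

(** The derivative may still be a step, but then its target has empty language and equals 0 by
    [lang_eq0]. *)
Lemma at_atom_reject e a :
  (forall p b w, ~ lang e (a, (p, b) :: w)) -> ~ lang e (a, [::]) ->
  (at_atom a e == at_atom a [? 0])%G.
Proof.
move=> hs h0; rewrite at_atom_deriv; case he: (deriv e a) => [||p e'] //=.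
  by case: h0; apply/lang_deriv.
rewrite (_ : (e' == [? 0])%G) ?geq_S3 //; apply: lang_eq0.
apply/seteqP; split=> // -[b w] /(lang_step _ _ he).
exact: hs.
Qed.

End Completeness.

Theorem theorem6p3 (Sigma : Type) (T : finType)
    (hSigma : inhabited Sigma) (hT : 0 < #|T|) (e1 e2 : exp Sigma T) :
  lang e1 = lang e2 -> gkat_eq e1 e2.
Proof.
move=> e12.
pose P := [seq x <- [seq (f1, f2) | f1 <- derivs e1, f2 <- derivs e2]
          | `[< lang x.1 = lang x.2 >]].
apply: (@coinduction _ _ P); last first.
  rewrite mem_filter; apply/andP; split; first exact/asboolP.
  by apply/allpairsP; exists (e1, e2); rewrite !mem_derivs.
move=> [f1 f2] a; rewrite mem_filter => /andP[/asboolP /= f12].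
move=> /allpairsP[[g1 g2] [/= f1in f2in [h1 h2]]]; subst g1 g2.
(* The case distinction is on languages, not on derivatives: with equal languages, one side may step
   to a dead expression where the other rejects or steps by a different action. *)
have [hp|hnp] := pselect (exists p b w, lang f1 (a, (p, b) :: w)).
  case: hp => p [b [w hw]].
  have /lang_deriv[/= g1 hg1 _] := hw.
  (* The same guarded string lies in both languages, which forces both steps to carry the action
     [p]. *)
  move: hw; rewrite f12 => /lang_deriv[/= g2 hg2 _].
  exists (Step p (g1, g2)); split; last 2 first.
  - by rewrite at_atom_deriv hg1.
  - by rewrite at_atom_deriv hg2.
  rewrite /= mem_filter; apply/andP; split.
    apply/asboolP/seteqP; split=> -[b' w'].
      by move=> /(lang_step _ _ hg1); rewrite f12 => /(lang_step _ _ hg2).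
    by move=> /(lang_step _ _ hg2); rewrite -f12 => /(lang_step _ _ hg1).
  apply/allpairsP; exists (g1, g2); split=> [||//].
    exact: derivs_step hg1.
  exact: derivs_step hg2.
have [h0|h0] := pselect (lang f1 (a, [::])).
  have /lang_deriv h1 := h0.
  move: h0; rewrite f12 => /lang_deriv h2.
  by exists Accept; split; rewrite /= // at_atom_deriv ?h1 ?h2.
(* No string of the common language starts with [a], so both sides are 0 there. *)
exists Reject; split=> //=.
  by apply: at_atom_reject => // p b w hw; apply: hnp; exists p, b, w.
apply: at_atom_reject; rewrite -f12 // => p b w hw.
by apply: hnp; exists p, b, w.
Qed.
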